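(* Let $q$ be a nonzero complex number that is not a root of unity. For all nonnegative integers $m$, $$\sum_{k=0}^{m-1} {2k \brack k}_{q^2}\,\frac{q^k}{(-q;q)_{2k}\,[k-m]_{q^2}} = -{2m \brack m}_{q^2}\,\frac{(1+q)\,q^m}{(-q;q)_{2m}} \sum_{k=1}^m \frac{q^{2k-1}}{[2k-1]_q}.$$
   Context: For a base $p$ (here $p=q$ or $p=q^2$): The $q$-Pochhammer symbol is $(a;p)_N:=\prod_{j=0}^{N-1}(1-ap^j)$ for nonnegative integers $N$, so that $(-q;q)_{2k}=\prod_{j=1}^{2k}(1+q^j)$. The $q$-binomial coefficient is ${n \brack m}_p:=\dfrac{(p;p)_n}{(p;p)_m(p;p)_{n-m}}$ if $0\le m\le n$, and $0$ otherwise. The $q$-integer is $[n]_p:=\dfrac{1-p^n}{1-p}$ for every integer $n$ (including negative $n$); in particular $[k-m]_{q^2}=\dfrac{1-q^{2k-2m}}{1-q^2}$. Empty sums (the case $m=0$) are $0$. *)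

(* Defs.v *)
From mathcomp Require Import all_boot all_order all_algebra.
From mathcomp Require Import reals complex.

Set Implicit Arguments.
Unset Strict Implicit.
Unset Printing Implicit Defensive.

Import GRing.Theory.
Local Open Scope ring_scope.

Definition qpoch (F : fieldType) (a p : F) (N : nat) : F :=
  \prod_(0 <= j < N) (1 - a * p ^+ j).

Definition qbinom (F : fieldType) (p : F) (n m : nat) : F :=
  if (m <= n)%N then qpoch p p n / (qpoch p p m * qpoch p p (n - m)) else 0.

Definition qint (F : fieldType) (p : F) (n : int) : F := (1 - p ^ n) / (1 - p).

(* The condition 0 < n is needed: n.-unity_root is always true at n = 0. *)
Definition not_root_of_unity (F : fieldType) (q : F) : Prop :=
  forall n : nat, (0 < n)%N -> ~~ n.-unity_root q.

(* Main.v *)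
Require Import Defs.
From mathcomp Require Import all_boot all_order all_algebra.
From mathcomp Require Import reals complex.
From mathcomp Require Import ring.

Import GRing.Theory.
Local Open Scope ring_scope.

(** Put p = q^2. Since (p;p)_n = (q;q)_n (-q;q)_n and
    (q;q)_2k = (q;p)_k (p;p)_k, the coefficients of both sides are those of the
    q-binomial theorem: [2k choose k]_p / (-q;q)_2k = (q;p)_k / (p;p)_k
    (lemma [qbinom_central]).  Up to the common factor -(1-p) q^m, the theorem
    is the case a = q of
      sum_(k < m) b_k a^(m-k) / (1 - p^(m-k))
        = b_m sum_(j < m) a p^j / (1 - a p^j),    b_k = (a;p)_k / (p;p)_k
    (lemma [qbinomial_theorem_deriv]).  This identity is the q-binomial theorem
      sum_k b_k z^k = (az;p)_oo / (z;p)_oo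
    to which a d/da is applied: the right-hand side comes from the
    logarithmic derivative of (a;p)_m, the left-hand side from the expansion
    of the logarithmic derivative of (az;p)_oo in powers of z.  The proof is
    purely algebraic: by induction on m the identity reduces to a first-order
    recurrence for its left-hand side ([qconv_rec]), and that in turn to the
    closed form of the geometric convolution sum_(k < n) b_k a^(n-k)
    ([qgeom_sum]). *)

Section Pochhammer.
Variable F : fieldType.
Implicit Types a p q : F.

Lemma qpoch0 a p : qpoch a p 0 = 1.
Proof. by rewrite /qpoch big_nil. Qed.

Lemma qpochS a p n : qpoch a p n.+1 = qpoch a p n * (1 - a * p ^+ n).
Proof. by rewrite /qpoch big_nat_recr. Qed.

Lemma qpoch_neq0 p n :
  (forall i, (0 < i)%N -> 1 - p ^+ i != 0) -> qpoch p p n != 0.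
Proof.
move=> np; elim: n => [|n IHn]; first by rewrite qpoch0 oner_neq0.
by rewrite qpochS mulf_neq0 // -exprS np.
Qed.

(** Factor by factor, 1 - q^2j = (1 - q^j) (1 + q^j). *)
Lemma qpoch_sqr q n :
  qpoch (q ^+ 2) (q ^+ 2) n = qpoch q q n * qpoch (- q) q n.
Proof.
elim: n => [|n IHn]; first by rewrite !qpoch0 mulr1.
by rewrite !qpochS IHn -[(q ^+ 2) ^+ n]exprM mulnC exprM; ring.
Qed.

(** The factors of (q;q)_2n are sorted by the parity of the exponent of q. *)
Lemma qpoch_double q n :
  qpoch q q (2 * n) = qpoch q (q ^+ 2) n * qpoch (q ^+ 2) (q ^+ 2) n.
Proof.
elim: n => [|n IHn]; first by rewrite !qpoch0 mulr1.
rewrite mulnS add2n !qpochS IHn -!exprM [q ^+ (2 * n).+1]exprS; ring.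
Qed.

Lemma qbinom_central q n : (forall i, (0 < i)%N -> 1 - q ^+ i != 0) ->
    qpoch (- q) q (2 * n) != 0 ->
  qbinom (q ^+ 2) (2 * n) n / qpoch (- q) q (2 * n) =
  qpoch q (q ^+ 2) n / qpoch (q ^+ 2) (q ^+ 2) n.
Proof.
move=> nq nz; have np : qpoch (q ^+ 2) (q ^+ 2) n != 0.
  by apply: qpoch_neq0 => i i0; rewrite -exprM nq // muln_gt0.
have -> : qbinom (q ^+ 2) (2 * n) n = qpoch (q ^+ 2) (q ^+ 2) (2 * n) /
    (qpoch (q ^+ 2) (q ^+ 2) n * qpoch (q ^+ 2) (q ^+ 2) n).
  by rewrite /qbinom leq_pmull // mul2n -addnn addnK.
rewrite qpoch_sqr qpoch_double; field.
by rewrite nz np.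
Qed.

End Pochhammer.

Section QBinomialDerivative.
Variables (F : fieldType) (a p : F).
Hypothesis p_nroot : forall i, (0 < i)%N -> 1 - p ^+ i != 0.

Definition qbcoef n := qpoch a p n / qpoch p p n.

Definition qconv n :=
  \sum_(0 <= k < n) qbcoef k * (a ^+ (n - k) / (1 - p ^+ (n - k))).

Lemma qbcoefS n : (1 - p ^+ n.+1) * qbcoef n.+1 = (1 - a * p ^+ n) * qbcoef n.
Proof.
rewrite /qbcoef !qpochS -exprS; field.
by rewrite p_nroot // qpoch_neq0.
Qed.

(** In generating functions, with f(z) = (az;p)_oo / (z;p)_oo, this is
    (1 - a) az / (1 - az) f(z) = a (f(z) - f(pz)), a rewriting of the functional
    equation (1 - z) f(z) = (1 - az) f(pz). *)
Lemma qgeom_sum n :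
  (1 - a) * (\sum_(0 <= k < n) qbcoef k * a ^+ (n - k)) =
  a * (1 - p ^+ n) * qbcoef n.
Proof.
elim: n => [|n IHn]; first by rewrite big_nil; ring.
rewrite -mulrA qbcoefS big_nat_recr //= subSnn expr1.
have -> : \sum_(0 <= k < n) qbcoef k * a ^+ (n.+1 - k) =
          a * \sum_(0 <= k < n) qbcoef k * a ^+ (n - k).
  rewrite mulr_sumr; apply: eq_big_nat => k /andP[_ kn].
  by rewrite (subSn (ltnW kn)) exprS; ring.
by rewrite mulrDr mulrCA IHn; ring.
Qed.

(** The weight 1 - p^n+1 is split as (1 - p^(n+1-k)) + p^(n+1-k) (1 - p^k):
    the first part cancels the denominator, and the second one lowers the index
    of b_k by [qbcoefS].  What differs from (1 - a p^n) times the convolution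
    at n is then a geometric convolution. *)
Lemma qconv_rec n :
  (1 - p ^+ n.+1) * qconv n.+1 =
  (1 - a * p ^+ n) * qconv n + a * p ^+ n * qbcoef n.
Proof.
have split_weight : (1 - p ^+ n.+1) * qconv n.+1 =
    \sum_(0 <= k < n.+1) qbcoef k * a ^+ (n.+1 - k) +
    \sum_(0 <= k < n.+1) ((1 - p ^+ k) * qbcoef k) *
       ((a * p) ^+ (n.+1 - k) / (1 - p ^+ (n.+1 - k))).
  rewrite -big_split mulr_sumr; apply: eq_big_nat => k /andP[_ kn] /=.
  have nz : 1 - p ^+ (n.+1 - k) != 0 by rewrite p_nroot // subn_gt0.
  rewrite -{1}(subnK (ltnW kn)) exprD exprMn; field.
  exact: nz.
have shift : \sum_(0 <= k < n.+1) ((1 - p ^+ k) * qbcoef k) *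
       ((a * p) ^+ (n.+1 - k) / (1 - p ^+ (n.+1 - k))) =
    (1 - a * p ^+ n) * qconv n - \sum_(0 <= k < n) qbcoef k * a ^+ (n - k).
  rewrite big_nat_recl // expr0 subrr !mul0r add0r.
  rewrite mulr_sumr -sumrB; apply: eq_big_nat => k /andP[_ kn].
  have nz : 1 - p ^+ (n - k) != 0 by rewrite p_nroot // subn_gt0.
  rewrite qbcoefS subSS -[in RHS](subnK (ltnW kn)) addnK exprD exprMn; field.
  exact: nz.
have sumS : \sum_(0 <= k < n.+1) qbcoef k * a ^+ (n.+1 - k) =
    a * \sum_(0 <= k < n) qbcoef k * a ^+ (n - k) + a * qbcoef n.
  rewrite big_nat_recr //= subSnn expr1 mulr_sumr [a * qbcoef n]mulrC.
  congr (_ + _); apply: eq_big_nat => k /andP[_ kn].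
  by rewrite (subSn (ltnW kn)) exprS; ring.
rewrite split_weight shift sumS.
have := qgeom_sum n; set G := \sum_(0 <= k < n) _ => EG.
have -> : a * p ^+ n * qbcoef n = a * qbcoef n - (1 - a) * G by rewrite EG; ring.
ring.
Qed.

Lemma qbinomial_theorem_deriv n : (forall j, 1 - a * p ^+ j != 0) ->
  qconv n = qbcoef n * \sum_(0 <= j < n) (a * p ^+ j) / (1 - a * p ^+ j).
Proof.
move=> na; elim: n => [|n IHn]; first by rewrite /qconv !big_nil mulr0.
apply: (mulfI (p_nroot n.+1 isT)).
rewrite qconv_rec [RHS]mulrA qbcoefS big_nat_recr //= IHn; field.
exact: na.
Qed.

End QBinomialDerivative.

(** 1 / (1 - q^-2d) = - q^2d / (1 - q^2d), and q^k q^2d = q^m q^d for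
    d = m - k. *)
Lemma qint_sub_inv (F : fieldType) (q : F) k m : q != 0 ->
    (forall i, (0 < i)%N -> 1 - q ^+ i != 0) -> (k < m)%N ->
  q ^+ k / qint (q ^+ 2) (k%:Z - m%:Z) =
  - ((1 - q ^+ 2) * q ^+ m) *
    (q ^+ (m - k) / (1 - (q ^+ 2) ^+ (m - k))).
Proof.
move=> q0 nq km.
have -> : k%:Z - m%:Z = - (m - k)%N%:Z by rewrite -subzn ?opprB // ltnW.
rewrite /qint -exprnN -[in q ^+ m](subnK (ltnW km)) exprD.
have n2 : 1 - q ^+ 2 != 0 by rewrite nq.
have : 1 - (q ^+ 2) ^+ (m - k) != 0 by rewrite -exprM nq // muln_gt0 subn_gt0.
rewrite exprAC; set x := q ^+ (m - k) => nx.
have x0 : x != 0 by rewrite expf_neq0.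
field.
by rewrite -[x ^+ 2 - 1]opprB oppr_eq0 nx x0 n2.
Qed.

Theorem theorem4p1 (R : realType) (q : R[i]) (q_neq0 : q != 0)
    (q_nroot : not_root_of_unity q) (m : nat) :
  \sum_(0 <= k < m)
     qbinom (q ^+ 2) (2 * k) k *
     (q ^+ k / (qpoch (- q) q (2 * k) * qint (q ^+ 2) (k%:Z - m%:Z)))
  = - (qbinom (q ^+ 2) (2 * m) m *
       (((1 + q) * q ^+ m) / qpoch (- q) q (2 * m)) *
       \sum_(1 <= k < m.+1) q ^+ (2 * k - 1) / qint q ((2 * k)%:Z - 1)).
Proof.
have nq i : (0 < i)%N -> 1 - q ^+ i != 0.
  move=> i0; rewrite subr_eq0 eq_sym.
  by have := q_nroot i i0; rewrite unity_rootE.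
have np i : (0 < i)%N -> 1 - (q ^+ 2) ^+ i != 0.
  by move=> i0; rewrite -exprM nq // muln_gt0.
have nodd j : 1 - q * (q ^+ 2) ^+ j != 0 by rewrite -exprM -exprS nq.
have nN n : qpoch (- q) q n != 0.
  have := qpoch_neq0 _ (q ^+ 2) n np.
  by rewrite qpoch_sqr mulf_eq0 negb_or => /andP[].
have coef n : qbinom (q ^+ 2) (2 * n) n / qpoch (- q) q (2 * n) =
    qbcoef _ q (q ^+ 2) n by exact: qbinom_central.
have -> : \sum_(1 <= k < m.+1) q ^+ (2 * k - 1) / qint q ((2 * k)%:Z - 1) =
    (1 - q) * \sum_(0 <= j < m) (q * (q ^+ 2) ^+ j) / (1 - q * (q ^+ 2) ^+ j).
  rewrite big_add1 /= mulr_sumr; apply: eq_bigr => j _.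
  have -> : (2 * j.+1)%:Z - 1 = (2 * j).+1%:Z by rewrite mulnS add2n subzn.
  rewrite mulnS add2n subn1 /= /qint -exprnP exprS exprM; field.
  by rewrite nodd -[X in 1 - X]expr1 nq.
transitivity (- ((1 - q ^+ 2) * q ^+ m) * qconv _ q (q ^+ 2) m).
  rewrite mulr_sumr; apply: eq_big_nat => k /andP[_ km].
  rewrite -coef [RHS]mulrCA -(qint_sub_inv _ q k m) // invfM; ring.
rewrite qbinomial_theorem_deriv // -coef; ring.
Qed.
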